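(* Let $D$ be an integral domain and $\star$ a semistar operation on $D$. The following are equivalent: (1) $D$ is a $\star$-Dedekind domain ($\star$-DD). (2) There exists an overring $T$ of $D$ such that $T$ is a Krull domain, $E^{\star_f}=(ET)^{t_T}$ for every $E\in\overline{\boldsymbol F}(D)$, and, for each $t_T$-maximal ideal $Q$ of $T$, $D_{Q\cap D}=T_Q$.
   Context: Let $D$ be an integral domain with quotient field $K$. An overring of $D$ is a ring $T$ with $D\subseteq T\subseteq K$. $\overline{\boldsymbol F}(D)$ denotes the set of all nonzero $D$-submodules of $K$, and $\boldsymbol f(D)$ the set of nonzero finitely generated $D$-submodules of $K$. A semistar operation on $D$ is a map $\star:\overline{\boldsymbol F}(D)\to\overline{\boldsymbol F}(D)$, $E\mapsto E^\star$, such that for all $0\neq x\in K$ and $E,F\in\overline{\boldsymbol F}(D)$: $(xE)^\star=xE^\star$; $E\subseteq F$ implies $E^\star\subseteq F^\star$; $E\subseteq E^\star$ and $(E^\star)^\star=E^\star$. The semistar operation $\star_f$ is defined by $E^{\star_f}:=\bigcup\{F^\star : F\in\boldsymbol f(D),\ F\subseteq E\}$. A quasi-$\star$-ideal of $D$ is a nonzero ideal $I$ of $D$ with $I=I^\star\cap D$. $D$ is $\star$-Noetherian if it has the ascending chain condition on quasi-$\star$-ideals. A nonzero ideal $I$ is $\star$-invertible if $(II^{-1})^\star=D^\star$, where $I^{-1}=\{z\in K: zI\subseteq D\}$. $D$ is a P$\star$MD if each nonzero finitely generated ideal of $D$ is $\star_f$-invertible. $D$ is a $\star$-Dedekind domain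 ($\star$-DD) if it is $\star$-Noetherian and a P$\star$MD. For a domain $T$ with quotient field $K$, the $v$-operation is $E^{v_T}:=(T:(T:E))$, where $(T:E)=\{z\in K: zE\subseteq T\}$ and $(T:0)=K$, and the $t$-operation is $t_T:=(v_T)_f$. A $t_T$-maximal ideal of $T$ is a maximal element of the set of proper nonzero ideals $I$ of $T$ with $I^{t_T}=I$. Fields are regarded as Krull domains. *)

(* Defs.v *)
From mathcomp Require Import all_boot all_order all_algebra.
From mathcomp Require Import boolp classical_sets cardinality.

Set Implicit Arguments.
Unset Strict Implicit.
Unset Printing Implicit Defensive.

Import GRing.Theory.

Local Open Scope classical_set_scope.
Local Open Scope ring_scope.

(* Integral domains are represented as subrings of a fixed field K, and modules,
   ideals and overrings as subsets of K.  R always denotes such a subring. *)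
Section Semistar.
Variable K : fieldType.
Implicit Types (R D T E F I J P Q : set K) (s star : set K -> set K).

Definition has_quotient_field R : Prop :=
  GRing.subring_closed (mem R) /\
  forall x : K, exists a b : K, [/\ R a, R b, b != 0 & x = a / b].

Definition overring D T : Prop := GRing.subring_closed (mem T) /\ D `<=` T.

Definition submodule R E : Prop :=
  [/\ E 0,
      forall x y, E x -> E y -> E (x + y) &
      forall a x, R a -> E x -> E (a * x)].

Definition Fbar R E : Prop := submodule R E /\ E <> [set 0].

Definition fg_span R n (x : 'I_n -> K) : set K :=
  [set y | exists2 a : 'I_n -> K, (forall i, R (a i)) & y = \sum_i a i * x i].

Definition fgen R F : Prop :=
  Fbar R F /\ exists n, exists x : 'I_n -> K, F = fg_span R x.

Definition nonzero_ideal R I : Prop := Fbar R I /\ I `<=` R.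

Definition scale (x : K) E : set K := [set x * e | e in E].

Definition mulmod E F : set K :=
  [set z | exists n, exists x y : 'I_n -> K,
     [/\ forall i, E (x i), forall i, F (y i) & z = \sum_i x i * y i]].

(* (R : E).  One has colon R [set 0] = setT, which is the convention (T : 0) = K. *)
Definition colon R E : set K := [set z | forall e, E e -> R (z * e)].

Definition localization R P : set K :=
  [set x | exists a b : K, [/\ R a, R b, ~ P b & x = a / b]].

(* A semistar operation is a total function on subsets of K of which only the
   restriction to Fbar D matters. *)
Record semistar D star : Prop := Semistar {
  semistar_Fbar : forall E, Fbar D E -> Fbar D (star E);
  semistar_scale : forall (x : K) E, x != 0 -> Fbar D E ->
    star (scale x E) = scale x (star E);
  semistar_mono : forall E F, Fbar D E -> Fbar D F ->
    E `<=` F -> star E `<=` star F;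
  semistar_ext : forall E, Fbar D E -> E `<=` star E;
  semistar_idem : forall E, Fbar D E -> star (star E) = star E
}.

Definition finite_type R s E : set K :=
  [set x | exists F, [/\ fgen R F, F `<=` E & s F x]].

Definition quasi_ideal D star I : Prop :=
  nonzero_ideal D I /\ I = star I `&` D.

Definition star_Noetherian D star : Prop :=
  forall I : nat -> set K,
    (forall n, quasi_ideal D star (I n)) ->
    (forall n, I n `<=` I n.+1) ->
    exists N, forall n, (N <= n)%N -> I n = I N.

Definition star_invertible D star I : Prop :=
  star (mulmod I (colon D I)) = star D.

Definition PstarMD D star : Prop :=
  forall I, nonzero_ideal D I -> fgen D I ->
    star_invertible D (finite_type D star) I.

Definition star_Dedekind D star : Prop :=
  star_Noetherian D star /\ PstarMD D star.

Definition v_op T E : set K := colon T (colon T E).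

Definition t_op T : set K -> set K := finite_type T (v_op T).

Definition proper_t_ideal T I : Prop :=
  [/\ nonzero_ideal T I, I <> T & t_op T I = I].

Definition t_maximal T Q : Prop :=
  proper_t_ideal T Q /\ forall J, proper_t_ideal T J -> Q `<=` J -> J = Q.

(* Normalized discrete rank-one valuation of K; the value at 0, morally +oo,
   is irrelevant. *)
Definition discrete_valuation (v : K -> int) : Prop :=
  [/\ forall x y : K, x != 0 -> y != 0 -> v (x * y) = v x + v y,
      forall x y : K, x != 0 -> y != 0 -> x + y != 0 ->
        Num.min (v x) (v y) <= v (x + y) &
      forall n : int, exists2 x : K, x != 0 & v x = n].

Definition valuation_ring (v : K -> int) : set K :=
  [set x : K | x != 0 -> 0 <= v x].

(* Krull domains with quotient field K, in the sense of Bourbaki: intersections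
   of a family, of finite character, of discrete valuation rings of K.  The empty
   family gives the field K itself. *)
Definition Krull T : Prop :=
  has_quotient_field T /\
  exists (Lambda : Type) (v : Lambda -> K -> int),
    [/\ forall l, discrete_valuation (v l),
        T = \bigcap_l valuation_ring (v l) &
        forall x : K, x != 0 -> finite_set [set l | v l x != 0]].

End Semistar.

(* Main.v *)
Require Import Defs.
From mathcomp Require Import all_boot all_order all_algebra.
From mathcomp Require Import boolp classical_sets cardinality.
From mathcomp Require Import ring zify.

(* Write F^* for [star F] and V_P for [localization D P].

   (1) => (2): take T := D^*.  If F is finitely generated, 1 lies in the star
   closure of F (D : F), hence F^* = (T : (T : F)); this gives the formula for the
   finite type operation.  By the ascending chain condition every nonzero ideal I
   contains a finitely generated F with I contained in F^*.  Let P be a prime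
   quasi-star-ideal.  For each finitely generated F some x in F and y in (D : F)
   have x y in D \ P; this shows that T is contained in V_P, that V_P is a discrete
   valuation ring, and that V_P = T_Q if Q is a prime of T over P.  T is the
   intersection of the V_P with P maximal.  The finite character of this family at
   a comes from the ideal of those d with d in a V_P for almost all maximal P
   containing a: it is finitely generated up to star closure.

   (2) => (1): in a Krull domain T every set I of elements of T has a finite subset
   with the same colon (T : I), because only finitely many valuations are positive
   at a given element of I; so t = v on ideals and chains of quasi-star-ideals
   stabilize.  If I (D : I) T were contained in a t-maximal Q, then, as I T is
   v-invertible, some i in I and y in (T : I) would have i y not in Q, and clearing
   the denominators of y I in D_P = T_Q, where P is the trace of Q on D, gives a
   contradiction. *)

Local Open Scope classical_set_scope.
Local Open Scope ring_scope.

(** * Submodules of a field *)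

Section Modules.
Set Implicit Arguments.
Unset Strict Implicit.
Import GRing.Theory.
Variable K : fieldType.
Implicit Types (R D T E F G I J P Q M : set K) (r : seq K).

Lemma subring1 R : GRing.subring_closed (mem R) -> R 1.
Proof. by case=> h _ _; rewrite -in_setE. Qed.

Lemma subringB R x y : GRing.subring_closed (mem R) -> R x -> R y -> R (x - y).
Proof. by case=> _ h _ hx hy; rewrite -in_setE; apply: h; apply/mem_set. Qed.

Lemma subringM R x y : GRing.subring_closed (mem R) -> R x -> R y -> R (x * y).
Proof. by case=> _ _ h hx hy; rewrite -in_setE; apply: h; apply/mem_set. Qed.

Lemma subring0 R : GRing.subring_closed (mem R) -> R 0.
Proof. by move=> h; rewrite -(subrr 1); apply: subringB => //; apply: subring1. Qed.

Lemma subringN R x : GRing.subring_closed (mem R) -> R x -> R (- x).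
Proof. by move=> h hx; rewrite -(sub0r x); apply: subringB => //; apply: subring0. Qed.

Lemma subringD R x y : GRing.subring_closed (mem R) -> R x -> R y -> R (x + y).
Proof. by move=> h hx hy; rewrite -(opprK y); apply: subringB => //; apply: subringN. Qed.

Lemma subringX R x n : GRing.subring_closed (mem R) -> R x -> R (x ^+ n).
Proof.
move=> h hx; elim: n => [|n IH]; first by rewrite expr0; apply: subring1.
by rewrite exprS; apply: subringM.
Qed.

Lemma subring_closed_intro R : R 1 -> (forall x y, R x -> R y -> R (x - y)) ->
  (forall x y, R x -> R y -> R (x * y)) -> GRing.subring_closed (mem R).
Proof.
move=> h1 hB hM; split; first exact/mem_set.
- by move=> x y /set_mem hx /set_mem hy; apply/mem_set/hB.
- by move=> x y /set_mem hx /set_mem hy; apply/mem_set/hM.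
Qed.

Lemma submodule_self R : GRing.subring_closed (mem R) -> submodule R R.
Proof.
move=> h; split; first exact: subring0.
- by move=> *; apply: subringD.
- by move=> *; apply: subringM.
Qed.

Lemma Fbar_intro R E x : submodule R E -> x != 0 -> E x -> Fbar R E.
Proof. by move=> h /eqP hx Ex; split=> // E0; apply: hx; rewrite E0 in Ex. Qed.

Lemma Fbar_neq0 R E : Fbar R E -> exists2 x, x != 0 & E x.
Proof.
case=> -[E0 _ _] hE; apply: contrapT => h; apply: hE.
apply/seteqP; split=> x /=; last by move=> ->.
by move=> Ex; apply: contrapT => /eqP hx; apply: h; exists x.
Qed.

Lemma Fbar_self R : GRing.subring_closed (mem R) -> Fbar R R.
Proof.
by move=> h; apply: (@Fbar_intro _ _ 1); rewrite ?oner_neq0 //;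
  [exact: submodule_self | exact: subring1].
Qed.

Lemma submodule_sum R E (J : Type) (s : seq J) (f : J -> K) :
  submodule R E -> (forall i, E (f i)) -> E (\sum_(i <- s) f i).
Proof. by case=> h0 hD _ hf; elim/big_ind: _. Qed.

Lemma submoduleM R E a x : submodule R E -> R a -> E x -> E (a * x).
Proof. by case=> _ _; apply. Qed.

Lemma submodule_scale R E x : submodule R E -> submodule R (scale x E).
Proof.
case=> h0 hD hM; split; first by exists 0; rewrite ?mulr0.
- by move=> _ _ [a Ea <-] [b Eb <-]; exists (a + b); rewrite ?mulrDr //; apply: hD.
- by move=> a _ Ra [b Eb <-]; exists (a * b); rewrite ?(mulrCA a) //; apply: hM.
Qed.

Lemma Fbar_scale R E x : x != 0 -> Fbar R E -> Fbar R (scale x E).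
Proof.
move=> x0 hE; have [y y0 Ey] := Fbar_neq0 hE; case: hE => hE _.
apply: (@Fbar_intro _ _ (x * y)); rewrite ?mulf_neq0 //; last by exists y.
exact: submodule_scale.
Qed.

Lemma submoduleI R E F : submodule R E -> submodule R F -> submodule R (E `&` F).
Proof.
case=> E0 ED EM [F0 FD FM]; split=> //.
- by move=> x y [? ?] [? ?]; split; [apply: ED|apply: FD].
- by move=> a x ? [? ?]; split; [apply: EM|apply: FM].
Qed.

Lemma submodule_sub R R' E : R `<=` R' -> submodule R' E -> submodule R E.
Proof. by move=> h [? ? hM]; split=> // a x /h; apply: hM. Qed.

(** Generators come as a list, so that adjoining or merging them and inducting on them are list
    operations. *)
Definition mspan R r : set K := fg_span R (tnth (in_tuple r)).

Lemma mspan_submodule R r : GRing.subring_closed (mem R) -> submodule R (mspan R r).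
Proof.
move=> h; split.
- exists (fun=> 0) => [i|]; first exact: subring0.
  by rewrite big1 // => i _; rewrite mul0r.
- move=> _ _ [a ha ->] [b hb ->]; exists (fun i => a i + b i).
    by move=> i; apply: subringD.
  by rewrite -big_split; apply: eq_bigr => i _; rewrite mulrDl.
- move=> c _ Rc [a ha ->]; exists (fun i => c * a i) => [i|]; first exact: subringM.
  by rewrite big_distrr; apply: eq_bigr => i _ /=; rewrite mulrA.
Qed.

Lemma mspan_mem R r x : GRing.subring_closed (mem R) -> x \in r -> mspan R r x.
Proof.
move=> h /(@tnthP _ _ (in_tuple r)) [i ->].
exists (fun j => (j == i)%:R) => [j|].
  by case: eqP => _; [apply: subring1|apply: subring0].
by rewrite (bigD1 i) //= eqxx mul1r big1 ?addr0 // => j /negbTE ->; rewrite mul0r.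
Qed.

Lemma mspan_min R r E : submodule R E -> (forall x, x \in r -> E x) ->
  mspan R r `<=` E.
Proof.
move=> hE hr _ [a ha ->]; apply: (submodule_sum _ hE) => i.
by apply: (submoduleM hE) => //; apply: hr; apply: mem_tnth.
Qed.

Lemma Fbar_mspan R r x : GRing.subring_closed (mem R) -> x != 0 -> x \in r ->
  Fbar R (mspan R r).
Proof.
by move=> h x0 xr; apply: (Fbar_intro (mspan_submodule r h) x0); apply: mspan_mem.
Qed.

Lemma fgen_mspan R r x : GRing.subring_closed (mem R) -> x != 0 -> x \in r ->
  fgen R (mspan R r).
Proof.
move=> h x0 xr; split; first exact: Fbar_mspan h x0 xr.
by exists (size r), (tnth (in_tuple r)).
Qed.

Lemma fgenP R F : GRing.subring_closed (mem R) -> fgen R F ->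
  Fbar R F /\ exists r, F = mspan R r.
Proof.
move=> h [hF [n [x FE]]]; split=> //; exists [seq x i | i : 'I_n].
have hx i : F (x i).
  rewrite FE; exists (fun j => (j == i)%:R) => [j|].
    by case: eqP => _; [apply: subring1|apply: subring0].
  by rewrite (bigD1 i) //= eqxx mul1r big1 ?addr0 // => j /negbTE ->; rewrite mul0r.
apply/seteqP; split; last first.
  by apply: mspan_min => [|y /codomP[i ->]]; [case: hF | exact: hx].
have hs := mspan_submodule [seq x i | i : 'I_n] h.
rewrite FE => _ [a ha ->]; apply: (submodule_sum _ hs) => i.
by apply: (submoduleM hs) => //; apply: mspan_mem => //; apply: codom_f.
Qed.

Lemma mspan_scale R c r : GRing.subring_closed (mem R) ->
  mspan R [seq c * x | x <- r] = scale c (mspan R r).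
Proof.
move=> h; apply/seteqP; split.
  apply: mspan_min; first exact/submodule_scale/mspan_submodule.
  by move=> _ /mapP[x xr ->]; exists x => //; apply: mspan_mem.
move=> _ [_ [a ha ->] <-]; rewrite big_distrr.
have hs := mspan_submodule [seq c * x | x <- r] h.
apply: (submodule_sum _ hs) => i /=; rewrite mulrCA.
apply: (submoduleM hs) => //; apply: mspan_mem => //.
by apply: map_f; apply: mem_tnth.
Qed.

Lemma fgen_self R : GRing.subring_closed (mem R) -> fgen R R.
Proof.
move=> h; have E : mspan R [:: 1] = R.
  apply/seteqP; split=> [|x Rx].
    apply: mspan_min; first exact: submodule_self.
    by move=> x; rewrite inE => /eqP ->; apply: subring1.
  rewrite -(mulr1 x); apply: (submoduleM (mspan_submodule _ h)) => //.
  by apply: mspan_mem; rewrite ?mem_head.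
by rewrite -{2}E; apply: (fgen_mspan h (oner_neq0 K)); rewrite mem_head.
Qed.

Lemma mulmod_mem E F x y : E x -> F y -> mulmod E F (x * y).
Proof.
by move=> Ex Fy; exists 1%N, (fun=> x), (fun=> y); rewrite big_ord1.
Qed.

Lemma mulmod_min R E F M : submodule R M ->
  (forall x y, E x -> F y -> M (x * y)) -> mulmod E F `<=` M.
Proof.
by move=> hM h _ [n [x [y [hx hy ->]]]]; apply: (submodule_sum _ hM) => i; apply: h.
Qed.

Lemma submodule_mulmod R E F : submodule R F -> submodule R (mulmod E F).
Proof.
case=> F0 _ FM; split.
- by exists 0%N, (fun=> 0), (fun=> 0); split; [case|case|rewrite big_ord0].
- move=> _ _ [n [x [y [hx hy ->]]]] [m [x' [y' [hx' hy' ->]]]].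
  pose g (u : 'I_n -> K) (v : 'I_m -> K) i :=
    match split i with inl j => u j | inr j => v j end.
  exists (n + m)%N, (g x x'), (g y y'); split.
  + by move=> i; rewrite /g; case: (split i).
  + by move=> i; rewrite /g; case: (split i).
  + rewrite big_split_ord /=; congr (_ + _); apply: eq_bigr => i _.
      by rewrite /g -[lshift m i]/(unsplit (inl i)) unsplitK.
    by rewrite /g -[rshift n i]/(unsplit (inr i)) unsplitK.
- move=> a _ Ra [n [x [y [hx hy ->]]]]; exists n, x, (fun i => a * y i); split=> //.
    by move=> i; apply: FM.
  by rewrite big_distrr; apply: eq_bigr => i _ /=; rewrite mulrCA.
Qed.

(** Two base rings occur because the product of a module over [D] with an overring [T] has to count
    as a module over [T]. *)
Lemma Fbar_mulmod R R' E F : Fbar R E -> Fbar R' F -> Fbar R' (mulmod E F).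
Proof.
move=> /Fbar_neq0[x x0 Ex] hF; have [y y0 Fy] := Fbar_neq0 hF.
apply: (@Fbar_intro _ _ (x * y)); rewrite ?mulf_neq0 //; last exact: mulmod_mem.
by case: hF => hF _; apply: submodule_mulmod.
Qed.

Lemma submodule_colon R E : GRing.subring_closed (mem R) -> submodule R (colon R E).
Proof.
move=> h; split.
- by move=> e _; rewrite mul0r; apply: subring0.
- by move=> x y hx hy e Ee; rewrite mulrDl; apply: subringD; [|apply: hx|apply: hy].
- by move=> a x Ra hx e Ee; rewrite -mulrA; apply: subringM => //; apply: hx.
Qed.

Lemma colon_sub R E F : E `<=` F -> colon R F `<=` colon R E.
Proof. by move=> EF z hz e /EF; apply: hz. Qed.

Lemma mspan_neq0 R r : GRing.subring_closed (mem R) -> Fbar R (mspan R r) ->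
  exists2 x, x != 0 & x \in r.
Proof.
move=> h hr; have [y y0 [a _ yE]] := Fbar_neq0 hr; apply: contrapT => hno.
move: y0; rewrite yE big1 ?eqxx // => i _.
have [->|xi] := eqVneq (tnth (in_tuple r) i) 0; first by rewrite mulr0.
by exfalso; apply: hno; exists (tnth (in_tuple r) i); rewrite ?mem_tnth.
Qed.

Lemma mspan_sub R R' r r' : GRing.subring_closed (mem R') -> R `<=` R' ->
  {subset r <= r'} -> mspan R r `<=` mspan R' r'.
Proof.
move=> h RR' rr'; apply: mspan_min.
  exact: submodule_sub RR' (mspan_submodule _ h).
by move=> x /rr' xr; apply: mspan_mem.
Qed.

Lemma submodule_preim_mul R E c : submodule R E -> submodule R [set e | E (c * e)].
Proof.
case=> h0 hD hM; split=> [|a b|a b Ra] /=; rewrite ?mulr0 ?mulrDr ?(mulrCA _ a) //.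
  exact: hD.
exact: hM.
Qed.

(** The right-hand side mentions only the list and [T], so the [D]-span and the [T]-span of one list
    have the same colon in [T] and the same [v_op T]. *)
Lemma colon_mspan R T r : GRing.subring_closed (mem R) -> GRing.subring_closed (mem T) ->
  R `<=` T -> colon T (mspan R r) = [set z | forall x, x \in r -> T (z * x)].
Proof.
move=> hR hT RT; apply/seteqP; split=> z hz.
  by move=> x xr; apply: hz; apply: mspan_mem.
apply: (mspan_min _ hz); apply: submodule_preim_mul.
exact: submodule_sub RT (submodule_self hT).
Qed.

Lemma sub_v_op R E : E `<=` v_op R E.
Proof. by move=> e Ee z hz; rewrite mulrC; apply: hz. Qed.

Lemma v_op_sub R E F : E `<=` F -> v_op R E `<=` v_op R F.
Proof. by move=> EF; do 2 apply: colon_sub. Qed.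

Lemma colon_v_op R E : colon R (v_op R E) = colon R E.
Proof.
apply/seteqP; split; first by apply: colon_sub; apply: sub_v_op.
by move=> z hz e he; rewrite mulrC; apply: he.
Qed.

Lemma colon_scale R x E : x != 0 -> colon R (scale x E) = scale x^-1 (colon R E).
Proof.
move=> x0; apply/seteqP; split=> z hz.
  exists (x * z); last by rewrite mulKf.
  move=> e Ee; have -> : x * z * e = z * (x * e) by ring.
  by apply: hz; exists e.
case: hz => y hy <- _ [e Ee <-]; by rewrite mulrACA mulVf // mul1r; apply: hy.
Qed.

(** This makes the results on quasi-star-ideals available for [v_op] on a Krull domain. *)
Lemma semistar_v_op R : GRing.subring_closed (mem R) -> semistar R (v_op R).
Proof.
move=> h; split.
- move=> E hE; have [x x0 Ex] := Fbar_neq0 hE.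
  by apply: (Fbar_intro _ x0); [exact: submodule_colon | exact: sub_v_op].
- move=> x E x0 _; rewrite /v_op colon_scale // colon_scale ?invr_neq0 //.
  by rewrite invrK.
- by move=> E F _ _; apply: v_op_sub.
- by move=> E _; apply: sub_v_op.
- by move=> E _; rewrite {1}/v_op colon_v_op.
Qed.

(** A common denominator of the generators is a nonzero element of the colon. *)
Lemma Fbar_colon_fgen R F : has_quotient_field R -> fgen R F -> Fbar R (colon R F).
Proof.
case=> h hq /(fgenP h)[_ [r ->]].
suff [s [Rs s0 hs]] : exists s, [/\ R s, s != 0 & forall x, x \in r -> R (s * x)].
  apply: (Fbar_intro (submodule_colon _ h) s0) => e.
  suff : mspan R r `<=` [set e | R (s * e)] by apply.
  apply: mspan_min hs; split; first by rewrite /= mulr0; apply: subring0.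
  - by move=> x y /= hx hy; rewrite mulrDr; apply: subringD.
  - by move=> a x Ra /= hx; rewrite mulrCA; apply: subringM.
elim: r => [|x r [s [Rs s0 hs]]].
  by exists 1; split; rewrite ?oner_neq0 //; apply: subring1.
have [a [b [Ra Rb b0 ->]]] := hq x.
exists (b * s); split; rewrite ?mulf_neq0 //; first exact: subringM.
move=> y; rewrite inE => /orP[/eqP ->|yr].
  by rewrite mulrC mulrA divfK //; apply: subringM.
by rewrite -mulrA; apply: subringM => //; apply: hs.
Qed.

End Modules.

(** * Quasi-star-ideals *)

Section Semistar.
Set Implicit Arguments.
Unset Strict Implicit.
Import GRing.Theory.
Variables (K : fieldType) (R : set K) (s : set K -> set K).
Hypotheses (hR : GRing.subring_closed (mem R)) (hs : semistar R s).
Implicit Types (E F I J P : set K) (r : seq K).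

Lemma semistar_submodule E : Fbar R E -> submodule R (s E).
Proof. by move=> /(semistar_Fbar hs)[]. Qed.

Lemma semistar_min E F : Fbar R E -> Fbar R F -> E `<=` s F -> s E `<=` s F.
Proof.
move=> hE hF EF; rewrite -(semistar_idem hs hF).
by apply: (semistar_mono hs) => //; apply: (semistar_Fbar hs).
Qed.

(** If [x] is nonzero, [scale x E] lies in [s F], hence so does its closure, which is
    [scale x (s E)]. *)
Lemma semistar_scale_sub E F x : Fbar R E -> Fbar R F ->
  (forall e, E e -> s F (x * e)) -> forall e, s E e -> s F (x * e).
Proof.
move=> hE hF h e he; have [->|x0] := eqVneq x 0.
  by rewrite mul0r; case: (semistar_submodule hF).
have : s (scale x E) `<=` s F.
  by apply: semistar_min => //; [exact: Fbar_scale | move=> _ [y Ey <-]; apply: h].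
by apply; rewrite (semistar_scale hs) //; exists e.
Qed.

Lemma Fbar_ideal I : nonzero_ideal R I -> Fbar R I.
Proof. by case. Qed.

Lemma quasi_closure I : nonzero_ideal R I -> quasi_ideal R s (s I `&` R).
Proof.
move=> [hI IR].
have hJ : Fbar R (s I `&` R).
  have [x x0 Ix] := Fbar_neq0 hI; apply: (Fbar_intro _ x0).
    by apply: submoduleI; [exact: semistar_submodule | exact: submodule_self].
  by split; [exact: (semistar_ext hs) | exact: IR].
split; first by split=> // x [].
apply/seteqP; split=> x [sx Rx]; split=> //; first by apply: (semistar_ext hs).
by apply: semistar_min sx => // y [].
Qed.

Lemma quasi_span_sub P r x : quasi_ideal R s P -> x != 0 -> x \in r ->
  (forall y, y \in r -> P y) -> s (mspan R r) `&` R `<=` P.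
Proof.
move=> [hP PE] x0 xr hr z [sz Rz]; rewrite PE; split=> //.
have hr' : Fbar R (mspan R r) by exact: Fbar_mspan x0 xr.
have hP' := Fbar_ideal hP.
apply: (semistar_mono hs hr' hP') sz; apply: mspan_min => //; by case: hP'.
Qed.

(** Otherwise dependent choice keeps adjoining an element of [I] outside the closure of the span so
    far, and the closures cut down to [R] form a chain that never stabilizes. *)
Lemma star_Noetherian_fg I : star_Noetherian R s -> nonzero_ideal R I ->
  exists r, [/\ exists2 x, x != 0 & x \in r, forall x, x \in r -> I x &
    I `<=` s (mspan R r)].
Proof.
move=> hN [hI IR]; apply: contrapT => hno.
pose good r := (exists2 x, x != 0 & x \in r) /\ forall x, x \in r -> I x.
have step (u : {r | good r}) :
    {v : {r | good r} | exists2 a, ~ s (mspan R (sval u)) a & sval v = a :: sval u}.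
  apply: cid; case: u => r [[x x0 xr] rI] /=.
  have [a [Ia na]] : exists a, I a /\ ~ s (mspan R r) a.
    apply: contrapT => h; apply: hno; exists r; split=> //; first by exists x.
    by move=> a Ia; apply: contrapT => na; apply: h; exists a.
  have gar : good (a :: r).
    split; first by exists x; rewrite ?inE ?xr ?orbT.
    by move=> y; rewrite inE => /orP[/eqP ->|/rI].
  by exists (exist _ _ gar); exists a.
have [x x0 Ix] := Fbar_neq0 hI.
have g0 : good [:: x].
  by split; [exists x; rewrite ?mem_head | move=> y; rewrite inE => /eqP ->].
have [f [_ hf]] := dependent_choice step (exist _ _ g0).
have good_ideal r : good r -> nonzero_ideal R (mspan R r).
  case=> -[y y0 yr] rI; split; first exact: Fbar_mspan y0 yr.
  by apply: mspan_min; [exact: submodule_self | move=> z /rI /IR].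
pose J n := s (mspan R (sval (f n))) `&` R.
have [n|n|N hN'] := hN J.
- exact/quasi_closure/good_ideal/(svalP (f n)).
- have [a _ E] := hf n; rewrite /J E => y [sy Ry]; split=> //.
  have [hn _] := good_ideal _ (svalP (f n)).
  have [hn1 _] := good_ideal _ (svalP (f n.+1)); rewrite E in hn1.
  apply: (semistar_mono hs) sy => //; apply: mspan_min; first by case: hn1.
  by move=> z zr; apply: mspan_mem; rewrite ?inE ?zr ?orbT.
- have [a na E] := hf N; apply: na.
  have Ia : I a by have [_] := svalP (f N.+1); apply; rewrite E mem_head.
  suff : J N.+1 a by rewrite (hN' N.+1) // => -[].
  split; last exact: IR.
  have [hn1 _] := good_ideal _ (svalP (f N.+1)).
  by apply: (semistar_ext hs) => //; rewrite E; apply: mspan_mem; rewrite ?mem_head.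
Qed.

(** The finite list found in the union of a chain lies in one member [J N], which is quasi-closed
    and so absorbs the union. The premise is about arbitrary subsets, so it applies to the union as
    it stands. *)
Lemma star_Noetherian_of_fg :
  (forall I, I `<=` R -> (exists2 x, x != 0 & I x) ->
    exists r, [/\ exists2 x, x != 0 & x \in r, forall x, x \in r -> I x &
      I `<=` s (mspan R r)]) ->
  star_Noetherian R s.
Proof.
move=> hfg J qJ mJ; have mono : forall n m, (n <= m)%N -> J n `<=` J m.
  move=> n m /subnK <-; elim: (m - n)%N => // k IH.
  by rewrite addSn => x hx; apply: mJ; apply: IH.
have [x x0 Jx] := Fbar_neq0 (proj1 (proj1 (qJ 0%N))).
have [|| r [[z z0 zr] rJ hr]] := hfg (\bigcup_n J n); last 1 first.
- have [N hN] : exists N, forall x, x \in r -> J N x.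
    elim: r rJ {z z0 zr hr} => [|u r IH] rJ; first by exists 0%N.
    have [|n hn] := IH; first by move=> w wr; apply: rJ; rewrite inE wr orbT.
    have [m _ hm] := rJ u (mem_head _ _).
    exists (maxn n m) => w; rewrite inE => /orP[/eqP ->|/hn].
      by move: hm; apply: mono; rewrite leq_maxr.
    by apply: mono; rewrite leq_maxl.
  exists N => n Nn; apply/seteqP; split; last exact: mono.
  move=> y Jy; have [[_ JR] _] := qJ n.
  apply: (quasi_span_sub (qJ N) z0 zr hN).
  by split; [apply: hr; exists n | apply: JR].
- by move=> y [n _]; have [[_ JR] _] := qJ n; apply: JR.
- by exists x => //; exists 0%N.
Qed.

Definition max_quasi P := [/\ quasi_ideal R s P, ~ P 1 &
  forall J, quasi_ideal R s J -> ~ J 1 -> P `<=` J -> J = P].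

(** The ascending chain condition stands in for Zorn's lemma: were no proper quasi-ideal above [I]
    maximal, dependent choice would give a strictly ascending chain starting at the closure of
    [I]. *)
Lemma max_quasi_exists I : star_Noetherian R s -> nonzero_ideal R I -> ~ s I 1 ->
  exists2 P, max_quasi P & I `<=` P.
Proof.
move=> hN hI nI; apply: contrapT => hno.
have hI' := Fbar_ideal hI.
pose good J := [/\ quasi_ideal R s J, ~ J 1 & I `<=` J].
have step (u : {J | good J}) :
    {v : {J | good J} | sval u `<=` sval v /\ sval u <> sval v}.
  apply: cid; case: u => P [qP nP IP] /=; apply: contrapT => h; apply: hno.
  exists P => //; split=> // J qJ nJ PJ; apply: contrapT => JP; apply: h.
  have gJ : good J by split=> // x /IP /PJ.
  by exists (exist _ _ gJ); split=> // E; apply: JP.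
have g0 : good (s I `&` R).
  split; [exact: quasi_closure | by case |].
  by move=> x Ix; split; [exact: (semistar_ext hs) | case: hI => _; apply].
have [f [_ hf]] := dependent_choice step (exist _ _ g0).
have [n|n|N hN'] := hN (fun n => sval (f n)).
- by case: (svalP (f n)).
- by case: (hf n).
- by have [_] := hf N; apply; rewrite (hN' N.+1).
Qed.

(** By maximality the closure of [P + R a] contains 1. As [b] multiplies [P + R a] into [P], it
    multiplies 1 into [s P], whose trace on [R] is [P]. *)
Lemma max_quasi_prime P a b : max_quasi P -> R a -> R b -> P (a * b) -> ~ P a -> P b.
Proof.
move=> [[hP PE] nP hmax] Ra Rb Pab nPa.
have hP' := Fbar_ideal hP; have [x x0 Px] := Fbar_neq0 hP'.
have sP := proj1 hP'.
pose I := [set z | exists2 p, P p & exists2 c, R c & z = p + c * a].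
have sI : submodule R I.
  split.
  - by exists 0; [case: sP | exists 0; rewrite ?mul0r ?addr0 //; exact: subring0].
  - move=> _ _ [p Pp [c Rc ->]] [q Pq [d Rd ->]]; exists (p + q).
      by case: sP => _ h _; apply: h.
    by exists (c + d); [exact: subringD | rewrite mulrDl addrACA].
  - move=> e _ Re [p Pp [c Rc ->]]; exists (e * p); first exact: (submoduleM sP).
    by exists (e * c); [exact: subringM | rewrite mulrDr mulrA].
have PI : P `<=` I.
  by move=> p Pp; exists p => //; exists 0; rewrite ?mul0r ?addr0 //; exact: subring0.
have hI : nonzero_ideal R I.
  split; first by apply: (Fbar_intro sI x0); apply: PI.
  move=> _ [p Pp [c Rc ->]]; apply: subringD => //; first by case: hP => _; apply.
  exact: subringM.
have hI' := Fbar_ideal hI.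
have sI1 : s I 1.
  apply: contrapT => n1; apply: nPa.
  rewrite -(hmax (s I `&` R)); first last.
  - by move=> p Pp; split; [exact/(semistar_ext hs)/PI | case: hP => _; apply].
  - by case.
  - exact: quasi_closure.
  split=> //; apply: (semistar_ext hs) => //.
  by exists 0; [case: sP | exists 1; rewrite ?mul1r ?add0r //; exact: subring1].
rewrite PE; split=> //; rewrite -(mulr1 b).
apply: semistar_scale_sub sI1 => // _ [p Pp [c Rc ->]]; apply: (semistar_ext hs) => //.
rewrite mulrDr; case: (sP) => _ hD _; apply: hD; first exact: (submoduleM sP).
by rewrite mulrCA mulrC (mulrC b) mulrC; apply: (submoduleM sP).
Qed.

End Semistar.

(** * Localizations and discrete valuations *)

Section Localization.
Set Implicit Arguments.
Unset Strict Implicit.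
Import GRing.Theory.
Variable K : fieldType.
Implicit Types (R T P Q F : set K) (r : seq K).

Definition prime_ideal R P := [/\ submodule R P, P `<=` R, ~ P 1 &
  forall a b, R a -> R b -> P (a * b) -> ~ P a -> P b].

Lemma prime_ideal_contract R T Q : GRing.subring_closed (mem R) -> R `<=` T ->
  prime_ideal T Q -> prime_ideal R (Q `&` R).
Proof.
move=> h RT [sQ QT n1 hpr]; split; [|by move=> x []|by case|].
  by apply: submoduleI; [exact: submodule_sub RT sQ|exact: submodule_self].
move=> a b Ra Rb [Qab _] nQa; split=> //; apply: hpr Qab _; try exact: RT.
by move=> Qa; apply: nQa.
Qed.

Variables R P : set K.
Hypotheses (hR : GRing.subring_closed (mem R)) (hP : prime_ideal R P).

Lemma prime_notin_neq0 b : ~ P b -> b != 0.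
Proof. by case: hP => -[P0 _ _] _ _ _ nb; apply/eqP => b0; rewrite b0 in nb. Qed.

Lemma prime_notinM a b : R a -> R b -> ~ P a -> ~ P b -> ~ P (a * b).
Proof. by case: hP => _ _ _ h Ra Rb na nb hab; apply: nb; exact: h hab na. Qed.

Lemma localization_frac a b : R a -> R b -> ~ P b -> localization R P (a / b).
Proof. by move=> *; exists a, b. Qed.

Lemma sub_localization : R `<=` localization R P.
Proof.
case: hP => _ _ n1 _ x Rx; exists x, 1; split; rewrite ?divr1 //; exact: subring1.
Qed.

Lemma localization_subring : GRing.subring_closed (mem (localization R P)).
Proof.
apply: subring_closed_intro; first by apply: sub_localization; apply: subring1.
- move=> _ _ [a [b [Ra Rb nb ->]]] [c [d [Rc Rd nd ->]]].
  exists (a * d - c * b), (b * d); split.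
  + by apply: subringB => //; apply: subringM.
  + exact: subringM.
  + exact: prime_notinM.
  + by field; rewrite (prime_notin_neq0 nb) (prime_notin_neq0 nd).
- move=> _ _ [a [b [Ra Rb nb ->]]] [c [d [Rc Rd nd ->]]].
  exists (a * c), (b * d); split; [exact: subringM..| exact: prime_notinM |].
  by rewrite mulf_div.
Qed.

Lemma localization_invN x : x != 0 -> P x -> ~ localization R P x^-1.
Proof.
case: (hP) => sP PR n1 hpr x0 Px [a [b [Ra Rb nb E]]].
have ba : b = a * x.
  by rewrite -(divfK (prime_notin_neq0 nb) a) -E mulrAC mulVf // mul1r.
by apply: nb; rewrite ba; exact: (submoduleM sP).
Qed.

(** The complement of a prime is multiplicative, so the denominators of the finitely many [c * x]
    can be multiplied together. *)
Lemma localization_denom r c : (forall x, x \in r -> localization R P (c * x)) ->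
  exists t, [/\ R t, ~ P t & forall x, x \in r -> R (t * (c * x))].
Proof.
case: (hP) => _ _ n1 _; elim: r => [_|x r IH h].
  by exists 1; split=> //; exact: subring1.
have [|t [Rt nt ht]] := IH; first by move=> y yr; apply: h; rewrite inE yr orbT.
have [a [b [Ra Rb nb E]]] := h x (mem_head _ _).
exists (b * t); split; [exact: subringM | exact: prime_notinM |].
move=> y; rewrite inE => /orP[/eqP ->|/ht hy]; last by rewrite -mulrA; apply: subringM.
rewrite E mulrC mulrA divfK; [exact: subringM | exact: prime_notin_neq0].
Qed.

End Localization.

(** * Discrete valuations: construction from a uniformizer, and basic values *)

Section DiscreteValuation.
Set Implicit Arguments.
Unset Strict Implicit.
Import Order.TTheory GRing.Theory Num.Theory.
Variable K : fieldType.

Section Build.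
Variables (V : set K) (p : K).
Hypotheses (hV : GRing.subring_closed (mem V)) (p0 : p != 0) (Vp : V p) (nVp : ~ V p^-1).

Lemma uniformizer_expz (m : int) : V (p ^ m) <-> 0 <= m.
Proof.
case: m => n; first by split=> // _; rewrite -exprnP; apply: subringX.
split=> //; rewrite NegzE -exprnN => h; exfalso; apply: nVp.
have -> : p^-1 = p ^- n.+1 * p ^+ n by rewrite exprS invfM divfK ?expf_neq0.
by apply: subringM => //; apply: subringX.
Qed.

(** The value of a nonzero [x] is the [n] for which [x / p ^ n] is a unit of [V]. Then
    [V (x / p ^ m)] holds exactly when [m <= v x], and the valuation axioms follow. *)
Lemma uniformizer_discrete_valuation :
  (forall x, x != 0 -> exists n : int, V (x / p ^ n) /\ V (x / p ^ n)^-1) ->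
  exists v, discrete_valuation v /\ valuation_ring v = V.
Proof.
move=> hv.
have /choice[v vP] : forall x, exists n : int,
    x != 0 -> V (x / p ^ n) /\ V (x / p ^ n)^-1.
  by move=> x; have [->|x0] := eqVneq x 0; [exists 0 | have [n hn] := hv x x0; exists n].
have pz m : p ^ m != 0 by rewrite expfz_neq0.
have mem x m : x != 0 -> V (x / p ^ m) <-> m <= v x.
  move=> x0; have [h1 h2] := vP x x0.
  rewrite -subr_ge0 -uniformizer_expz expfzDr // -invr_expz.
  split=> h.
    have -> : p ^ v x / p ^ m = x / p ^ m * (x / p ^ v x)^-1 by field; rewrite x0 !pz.
    exact: subringM.
  have -> : x / p ^ m = p ^ v x / p ^ m * (x / p ^ v x) by field; rewrite !pz.
  exact: subringM.
have inv_mem x m : x != 0 -> V (x / p ^ m)^-1 -> v x <= m.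
  move=> x0; have [h1 h2] := vP x x0 => h.
  rewrite -subr_ge0 -uniformizer_expz expfzDr // -invr_expz.
  have -> : p ^ m / p ^ v x = (x / p ^ m)^-1 * (x / p ^ v x) by field; rewrite x0 !pz.
  exact: subringM.
have uniq x m : x != 0 -> V (x / p ^ m) -> V (x / p ^ m)^-1 -> v x = m.
  move=> x0 h1 h2; apply/eqP; rewrite eq_le inv_mem //=; exact/mem.
exists v; split.
  split=> [x y x0 y0|x y x0 y0 xy0|n].
  - have [h1 h2] := vP x x0; have [h3 h4] := vP y y0.
    have E : x * y / p ^ (v x + v y) = x / p ^ v x * (y / p ^ v y).
      by rewrite expfzDr // -mulf_div.
    apply: uniq; rewrite ?mulf_neq0 // E; first exact: subringM.
    by rewrite invfM; apply: subringM.
  - apply/(mem (x + y) _ xy0); rewrite mulrDl; apply: subringD => //.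
      by apply/(mem x _ x0); rewrite ge_min lexx.
    by apply/(mem y _ y0); rewrite ge_min lexx orbT.
  - by exists (p ^ n) => //; apply: uniq; rewrite // divff ?invr1 //; apply: subring1.
apply/seteqP; split=> x.
  have [->|x0] := eqVneq x 0; first by move=> _; apply: subring0.
  by move=> /(_ x0) /(mem x 0 x0); rewrite expr0z divr1.
by move=> Vx x0; apply/(mem x 0 x0); rewrite expr0z divr1.
Qed.

End Build.

Variable v : K -> int.
Hypothesis hv : discrete_valuation v.

Lemma valuation1 : v 1 = 0.
Proof.
case: hv => hM _ _; have := hM 1 1 (oner_neq0 _) (oner_neq0 _).
by rewrite mulr1 => /eqP; rewrite -subr_eq subrr => /eqP.
Qed.

Lemma valuationV x : x != 0 -> v x^-1 = - v x.
Proof.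
move=> x0; case: hv => hM _ _; apply/eqP; rewrite -addr_eq0 -hM ?invr_neq0 //.
by rewrite mulVf // valuation1.
Qed.

Lemma valuationX x n : x != 0 -> v (x ^+ n) = v x *+ n.
Proof.
move=> x0; case: (hv) => hM _ _; elim: n => [|n IH]; first by rewrite valuation1.
by rewrite exprS hM ?expf_neq0 // IH mulrS.
Qed.

End DiscreteValuation.

(** * Star-Dedekind domains *)

Section StarDedekind.
Set Implicit Arguments.
Unset Strict Implicit.
Import Order.TTheory GRing.Theory Num.Theory.
Variables (K : fieldType) (D : set K) (star : set K -> set K).
Hypotheses (hD : has_quotient_field D) (hs : semistar D star).
Implicit Types (E F I J P : set K) (r : seq K).

Let hR : GRing.subring_closed (mem D) := proj1 hD.

(** For [x] in [star E], multiplication by [x] sends [D] into [star E], hence [star D] too. *)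
Lemma star_overring_submodule E : Fbar D E -> submodule (star D) (star E).
Proof.
move=> hE; have [s0 sD sM] := semistar_submodule hs hE; split=> // a x Da sx.
rewrite mulrC; move: a Da; apply: (semistar_scale_sub hs) => //; first exact: Fbar_self.
by move=> d Dd; rewrite mulrC; apply: sM.
Qed.

Lemma sub_star_self : D `<=` star D.
Proof. exact/(semistar_ext hs)/Fbar_self. Qed.

Lemma star_self_subring : GRing.subring_closed (mem (star D)).
Proof.
have sD := star_overring_submodule (Fbar_self hR).
have s1 : star D 1 by apply: sub_star_self; apply: subring1.
apply: subring_closed_intro => // [x y sx sy|x y sx sy]; last exact: (submoduleM sD).
case: (sD) => _ hA hM; apply: hA => //; rewrite -mulN1r; apply: hM => //.
by apply: sub_star_self; apply: subringN => //; apply: subring1.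
Qed.

Lemma fgen_Fbar F : fgen D F -> Fbar D F.
Proof. by case. Qed.

(** * Consequences of invertibility of finitely generated ideals *)

Section Prufer.
Hypothesis hP : PstarMD D star.

(** Scaling [F] by a denominator [c] gives an ideal of [D], to which [hP] applies; the factor [c] is
    then absorbed by the inverse. *)
Lemma PstarMD_inv F : fgen D F -> star (mulmod F (colon D F)) 1.
Proof.
move=> hF; have hF' := fgen_Fbar hF.
have [c c0 cF] := Fbar_neq0 (Fbar_colon_fgen hD hF).
have [_ [r FE]] := fgenP hR hF.
have cFD : scale c F `<=` D by move=> _ [f Ff <-]; apply: cF.
have hcF : Fbar D (scale c F) by apply: Fbar_scale.
have hcF' : fgen D (scale c F).
  by split=> //; exists (size (map ( *%R c) r)); rewrite FE -mspan_scale //; eexists.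
have := hP (conj hcF cFD) hcF'; rewrite /star_invertible => E.
have hD1 : finite_type D star D 1.
  exists D; split=> //; first exact: fgen_self.
  by apply: sub_star_self; apply: subring1.
move: hD1; rewrite -E => -[G [hG GI sG]].
have GF : G `<=` mulmod F (colon D F).
  move=> g /GI; apply: (mulmod_min (R := D)).
    exact/submodule_mulmod/submodule_colon.
  move=> _ y [f Ff <-] hy; rewrite (mulrC c) -mulrA; apply: mulmod_mem => // e Fe.
  by rewrite mulrAC mulrC; apply: hy; exists e.
apply: (semistar_mono hs) sG => //; first exact: fgen_Fbar.
exact/(Fbar_mulmod hF')/Fbar_colon_fgen.
Qed.

(** For the harder inclusion, an [x] in the right-hand side multiplies [mulmod F (colon D F)] into
    [star F], because [star F] is a module over [star D]. As 1 lies in the closure of that product,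
    [x] lies in [star F]. *)
Lemma star_fgen F : fgen D F -> star F = v_op (star D) F.
Proof.
move=> hF; have hF' := fgen_Fbar hF; have hDD := Fbar_self hR.
apply/seteqP; split=> x.
  move=> sx z hz; rewrite mulrC; move: x sx.
  by apply: (semistar_scale_sub hs).
move=> hx; rewrite -(mulr1 x).
apply: (semistar_scale_sub hs _ hF' _ (PstarMD_inv hF)).
  exact/(Fbar_mulmod hF')/Fbar_colon_fgen.
move=> m hm.
have hsF := submodule_preim_mul x (star_overring_submodule hF').
move: m hm; apply: (mulmod_min hsF) => f y Ff hy /=.
rewrite mulrCA mulrC; apply: (submoduleM (star_overring_submodule hF')).
  by apply: hx => e Fe; apply: sub_star_self; apply: hy.
exact: (semistar_ext hs).
Qed.

(** If all products were in [P], then 1 would be in [star P] and so in [P]. When [P] is prime,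
    [x * y] is a unit of [V_P], so [x] generates [F] there. *)
Lemma quasi_inverse P F : quasi_ideal D star P -> ~ P 1 -> fgen D F ->
  exists x y, [/\ F x, colon D F y & ~ P (x * y)].
Proof.
move=> [[hPF PD] PE] n1 hF; apply: contrapT => hno; apply: n1.
rewrite PE; split; last exact: subring1.
have hF' := fgen_Fbar hF.
apply: (semistar_mono hs) (PstarMD_inv hF) => //.
  exact/(Fbar_mulmod hF')/Fbar_colon_fgen.
apply: (mulmod_min (proj1 hPF)) => x y Fx hy; apply: contrapT => h.
by apply: hno; exists x, y.
Qed.

(** * Localization at a prime quasi-star-ideal *)

Section Prime.
Variable P : set K.
Hypotheses (qP : quasi_ideal D star P) (hpr : prime_ideal D P).
Let V := localization D P.

Let hV : GRing.subring_closed (mem V).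
Proof. exact: localization_subring. Qed.

(** For [t = a / b], an inverse element [y] for the module spanned by [a] and [b] rewrites [t] as
    [(y * a) / (y * b)], a fraction over [D] whose denominator avoids [P]. *)
Lemma star_self_sub_localization : star D `<=` V.
Proof.
move=> t Tt; have [a [b [Da Db b0 tE]]] := proj2 hD t.
have [hPF PE] := qP; have [sP PD n1 _] := hpr.
have hF : fgen D (mspan D [:: a; b]) by apply: (fgen_mspan hR b0); rewrite !inE eqxx orbT.
have [x [y [Fx hy nP]]] := quasi_inverse qP n1 hF.
have Dya : D (y * a) by apply: hy; apply: mspan_mem; rewrite // !inE eqxx.
have Dyb : D (y * b) by apply: hy; apply: mspan_mem; rewrite // !inE eqxx orbT.
(* If [y * b] were in [P], so would be [y * a = t * (y * b)], since [star P] is a module over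
   [star D]; then [y] would send the whole span into [P], against [nP]. *)
have nPb : ~ P (y * b).
  move=> Pb; apply: nP; rewrite mulrC.
  have Pa : P (y * a).
    rewrite PE; split=> //.
    have -> : y * a = t * (y * b) by rewrite tE; field.
    apply: (submoduleM (star_overring_submodule (Fbar_ideal hPF))) => //.
    exact/(semistar_ext hs)/Pb/(Fbar_ideal hPF).
  apply: (mspan_min (submodule_preim_mul y sP)) Fx.
  by move=> z; rewrite !inE => /orP[] /eqP ->.
have -> : t = (y * a) / (y * b).
  have := prime_notin_neq0 hpr nPb; rewrite mulf_eq0 negb_or => /andP[y0 _].
  by rewrite tE; field; rewrite b0 y0.
exact: localization_frac.
Qed.

(** A common denominator [t] outside [P] brings [t * c * F] into [D], hence [t * c * star F] into
    [star D] and so into [V]. *)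
Lemma star_fgen_sub_localization F c : fgen D F -> (forall x, F x -> V (c * x)) ->
  forall x, star F x -> V (c * x).
Proof.
move=> hF h x sx; have hF' := fgen_Fbar hF.
have [_ [r FE]] := fgenP hR hF.
have [t [Dt nt ht]] : exists t, [/\ D t, ~ P t & forall x, x \in r -> D (t * (c * x))].
  apply: (localization_denom hR hpr) => y yr.
  by apply: h; rewrite FE; apply: mspan_mem.
have t0 := prime_notin_neq0 hpr nt.
have -> : c * x = t^-1 * (t * c * x) by rewrite -!mulrA mulKf.
apply: subringM => //.
  rewrite -(mul1r t^-1); apply: localization_frac => //; exact: subring1.
apply: star_self_sub_localization; move: x sx.
apply: (semistar_scale_sub hs hF' (Fbar_self hR)) => e.
rewrite FE => he; apply: sub_star_self.
apply: (mspan_min (submodule_preim_mul (t * c) (submodule_self hR))) he => y yr /=.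
by rewrite -mulrA; apply: ht.
Qed.

Hypothesis hN : star_Noetherian D star.

(** Prescribing the element [a] of [F] ensures that [y * a] is in [D], which the finiteness of the
    set of maximal [P] containing [a] will use. *)
Lemma quasi_prime_inverse a : P a -> exists F x y,
  [/\ [/\ fgen D F, F `<=` P, P `<=` star F & F a], F x, colon D F y & ~ P (x * y)].
Proof.
move=> Pa; have [hPF _] := qP; have [sP PD n1 _] := hpr.
have [r [[z z0 zr] rP Ps]] := star_Noetherian_fg hR hs hN hPF.
have hF : fgen D (mspan D (a :: r)) by apply: (fgen_mspan hR z0); rewrite inE zr orbT.
have [x [y [Fx hy nP]]] := quasi_inverse qP n1 hF.
exists (mspan D (a :: r)), x, y; split=> //; split=> //.
- by apply: mspan_min => // w; rewrite inE => /orP[/eqP ->|/rP].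
- move=> w /Ps; apply: (semistar_mono hs); [exact: Fbar_mspan z0 zr|exact: fgen_Fbar|].
  apply: mspan_min; first exact: mspan_submodule.
  by move=> u ur; apply: mspan_mem; rewrite // inE ur orbT.
- by apply: mspan_mem; rewrite // mem_head.
Qed.

(** The [x] of [quasi_prime_inverse] serves: [P] lies in [star F], so [y * z] is in [star D], and
    [z / x] is [y * z] divided by the unit [x * y] of [V]. *)
Lemma uniformizer_exists : exists p, [/\ p != 0, P p & forall z, P z -> V (z / p)].
Proof.
have [sP PD n1 _] := hpr; have P0 : P 0 by case: sP.
(* No particular element of [P] has to lie in [F] here, so 0 is prescribed. *)
have [F [x [y [[hF FP PF _] Fx hy nP]]]] := quasi_prime_inverse P0.
exists x; split=> [||z Pz]; last first.
- have x0 := prime_notin_neq0 hpr nP; move: (x0); rewrite mulf_eq0 negb_or => /andP[x1 y1].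
  have -> : z / x = y * z * (1 / (x * y)) by field; rewrite x1 y1.
  apply: subringM => //; last first.
    apply: localization_frac => //; first exact: subring1.
    by rewrite mulrC; apply: hy.
  apply: star_self_sub_localization; move: z {Pz} (PF _ Pz).
  apply: (semistar_scale_sub hs (fgen_Fbar hF) (Fbar_self hR)) => e Fe.
  by apply: sub_star_self; apply: hy.
- exact: FP.
- by have := prime_notin_neq0 hpr nP; rewrite mulf_eq0 negb_or => /andP[].
Qed.

(** If all powers of [p] divided [x], they would divide its numerator [a]. The ideals of those [d]
    in [D] with [p ^+ n / a * d] in [V] ascend with [n]; their union [A] is finitely generated up to
    closure, which bounds the exponent and forces [p^-1] into [V]. *)
Lemma not_infinitely_divisible p x : p != 0 -> P p -> x != 0 ->
  exists n : nat, ~ V (x / p ^+ n).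
Proof.
move=> p0 Pp x0; apply: contrapT => hno.
have {hno} hx n : V (x / p ^+ n) by apply: contrapT => h; apply: hno; exists n.
have Vx : V x by have := hx 0%N; rewrite expr0 divr1.
have [sP PD n1 _] := hpr.
have [a [s [Da Ds ns xE]]] := Vx.
have s0 := prime_notin_neq0 hpr ns.
have a0 : a != 0 by apply/eqP => z; move: x0; rewrite xE z mul0r eqxx.
have Vp : V p by apply: sub_localization => //; apply: PD.
have ha n : V (a / p ^+ n).
  have -> : a / p ^+ n = s * (x / p ^+ n) by rewrite xE; field; rewrite s0 expf_neq0.
  by apply: subringM => //; apply: sub_localization.
pose A := [set d | D d /\ exists n : nat, V (p ^+ n / a * d)].
have monoA d (n m : nat) : (n <= m)%N -> V (p ^+ n / a * d) -> V (p ^+ m / a * d).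
  move=> nm h; rewrite -(subnK nm) exprD -!mulrA mulrA -mulrA.
  by apply: subringM; rewrite ?mulrA //; apply: subringX.
have sA : submodule D A.
  split.
  - by split; [apply: subring0 | exists 0%N; rewrite mulr0; apply: subring0].
  - move=> u v [Du [n hn]] [Dv [m hm]]; split; first exact: subringD.
    exists (maxn n m); rewrite mulrDr; apply: subringD => //.
      by apply: monoA hn; rewrite leq_maxl.
    by apply: monoA hm; rewrite leq_maxr.
  - move=> c u Dc [Du [n hn]]; split; first exact: subringM.
    by exists n; rewrite mulrCA; apply: subringM => //; apply: sub_localization.
have hA : nonzero_ideal D A.
  split; last by move=> u [].
  apply: (Fbar_intro sA a0); split=> //; exists 0%N; rewrite expr0 mul1r mulVf //.
  exact: subring1.
have [r [[z z0 zr] rA As]] := star_Noetherian_fg hR hs hN hA.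
have [N hNr] : exists N, forall u, u \in r -> V (p ^+ N / a * u).
  elim: r rA {z z0 zr As} => [|u r IH] rA; first by exists 0%N.
  have [|n hn] := IH; first by move=> v vr; apply: rA; rewrite inE vr orbT.
  have [_ [m hm]] := rA u (mem_head _ _).
  exists (maxn n m) => v; rewrite inE => /orP[/eqP ->|/hn h].
    by apply: monoA hm; rewrite leq_maxr.
  by apply: monoA h; rewrite leq_maxl.
have hAN u : A u -> V (p ^+ N / a * u).
  move=> /As; apply: star_fgen_sub_localization; first exact: fgen_mspan z0 zr.
  apply: mspan_min => //; apply: submodule_preim_mul.
  exact: submodule_sub (sub_localization hR hpr) (submodule_self hV).
(* The numerator [b] of [a / p ^+ N.+1] lies in [A] thanks to the exponent [N.+1]; applying [hAN],
   with exponent [N], leaves [t / p] in [V]. *)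
have [b [t [Db Dt nt E]]] := ha N.+1.
have t0 := prime_notin_neq0 hpr nt.
have pN : p ^+ N != 0 by rewrite expf_neq0.
have bE : b = t * (a / p ^+ N.+1) by rewrite E mulrC divfK.
have /hAN : A b.
  split=> //; exists N.+1; rewrite bE exprS.
  have -> : p * p ^+ N / a * (t * (a / (p * p ^+ N))) = t by field; rewrite a0 p0 pN.
  exact: sub_localization.
rewrite bE exprS.
have -> : p ^+ N / a * (t * (a / (p * p ^+ N))) = t / p by field; rewrite a0 p0 pN.
move=> h; apply: (localization_invN hpr p0 Pp).
have -> : p^-1 = (t / p) * (1 / t) by field; rewrite p0 t0.
by apply: subringM => //; apply: localization_frac => //; apply: subring1.
Qed.

(** A nonzero [x] in [D] is a unit of [V] times [p ^ n], where [n.+1] is the least exponent with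
    [x / p ^+ n.+1] outside [V]. For fractions the exponents are subtracted. *)
Lemma quasi_prime_valuation :
  exists v, discrete_valuation v /\ valuation_ring v = V.
Proof.
have [p [p0 Pp hp]] := uniformizer_exists.
have [sP PD n1 _] := hpr.
have Vp : V p by apply: sub_localization => //; apply: PD.
apply: (uniformizer_discrete_valuation hV p0 Vp); first exact: localization_invN.
have hD1 x : D x -> x != 0 -> exists n : int, V (x / p ^ n) /\ V (x / p ^ n)^-1.
  move=> Dx x0.
  have h : exists n : nat, ~~ `[< V (x / p ^+ n) >].
    by have [n hn] := not_infinitely_divisible p0 Pp x0; exists n; apply/asboolPn.
  case: (ex_minnP h) => [[|n] /asboolPn hn hmin].
    by exfalso; apply: hn; rewrite expr0 divr1; apply: sub_localization.
  have Vn : V (x / p ^+ n).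
    by apply: contrapT => /asboolPn /hmin; rewrite ltnn.
  exists n; split=> //; rewrite -exprnP.
  have [b [s [Db Ds ns E]]] := Vn; rewrite E.
  have s0 := prime_notin_neq0 hpr ns.
  (* A numerator in [P] would allow one more division by [p]. *)
  rewrite invf_div; apply: localization_frac => // Pb; apply: hn.
  have -> : x / p ^+ n.+1 = x / p ^+ n / p by rewrite exprSr invfM mulrA mulrAC.
  rewrite E.
  have -> : b / s / p = b / p * (1 / s) by field; rewrite s0 p0.
  apply: subringM => //; first exact: hp.
  by apply: localization_frac => //; apply: subring1.
move=> x x0; have [a [b [Da Db b0 xE]]] := proj2 hD x.
have a0 : a != 0 by apply/eqP => z; move: x0; rewrite xE z mul0r eqxx.
have [n [h1 h2]] := hD1 a Da a0; have [m [h3 h4]] := hD1 b Db b0.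
have pn : p ^ n != 0 by rewrite expfz_neq0.
have pm : p ^ m != 0 by rewrite expfz_neq0.
exists (n - m); rewrite expfzDr // -invr_expz xE; split.
  have -> : a / b / (p ^ n / p ^ m) = a / p ^ n * (b / p ^ m)^-1.
    by field; rewrite b0 pn pm.
  exact: subringM.
have -> : (a / b / (p ^ n / p ^ m))^-1 = (a / p ^ n)^-1 * (b / p ^ m).
  by field; rewrite b0 a0 pn pm.
exact: subringM.
Qed.

End Prime.
End Prufer.
End StarDedekind.

(** * The Krull overring [star D] and the formula for the finite type operation *)

Section StarDedekindKrull.
Set Implicit Arguments.
Unset Strict Implicit.
Import Order.TTheory GRing.Theory Num.Theory.
Variables (K : fieldType) (D : set K) (star : set K -> set K).
Hypotheses (hD : has_quotient_field D) (hs : semistar D star).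
Hypotheses (hN : star_Noetherian D star) (hP : PstarMD D star).
Implicit Types (E F I J P Q : set K) (r : seq K).

Let hR : GRing.subring_closed (mem D) := proj1 hD.

Lemma max_quasi_prime_ideal (R : set K) s P : GRing.subring_closed (mem R) ->
  semistar R s -> max_quasi R s P -> prime_ideal R P.
Proof.
move=> h hs' mP; have [[[[sP _] PR] _] n1 _] := mP.
by split=> // a b Ra Rb Pab; apply: (max_quasi_prime h hs' mP).
Qed.

Lemma star_self_bigcap :
  star D = [set x | forall P, max_quasi D star P -> localization D P x].
Proof.
apply/seteqP; split=> [x Tx P mP|x hx].
  have [qP _ _] := mP.
  by apply: (star_self_sub_localization hD hs hP qP (max_quasi_prime_ideal hR hs mP)).
(* The ideal of denominators of [x]: if its closure contains 1, then [x] is in [star D]. Otherwise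
   it lies in a maximal [P], although [x] in [V_P] provides a denominator outside [P]. *)
pose I := [set d | D d /\ D (x * d)].
have sI : submodule D I.
  split.
  - by split; rewrite ?mulr0; apply: subring0.
  - by move=> u v [Du hu] [Dv hv]; split; rewrite ?mulrDr; apply: subringD.
  - by move=> c u Dc [Du hu]; split; rewrite ?(mulrCA _ c); apply: subringM.
have hI : nonzero_ideal D I.
  split; last by move=> u [].
  have [a [b [Da Db b0 xE]]] := proj2 hD x.
  by apply: (Fbar_intro sI b0); split=> //; rewrite xE divfK.
have [sI1|nI1] := pselect (star I 1).
  rewrite -(mulr1 x).
  apply: (semistar_scale_sub hs (Fbar_ideal hI) (Fbar_self hR) _ sI1) => e [_ De].
  exact: (sub_star_self hD hs).
have [P mP IP] := max_quasi_exists hR hs hN hI nI1.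
have [a [b [Da Db nb xE]]] := hx P mP.
have b0 := prime_notin_neq0 (max_quasi_prime_ideal hR hs mP) nb.
by exfalso; apply/nb/IP; split=> //; rewrite xE divfK.
Qed.

(** Each of the finitely many generators of [B] up to closure has finitely many bad primes, and
    every maximal [P] containing [a] turns out to be bad for one of them. *)
Lemma finitely_many_max_quasi a : D a -> a != 0 ->
  finite_set [set P | max_quasi D star P /\ P a].
Proof.
move=> Da a0.
pose bad d := [set P | [/\ max_quasi D star P, P a & ~ localization D P (a^-1 * d)]].
pose B := [set d | D d /\ finite_set (bad d)].
have sB : submodule D B.
  split.
  - split; first exact: subring0.
    apply: sub_finite_set (finite_set0 _) => P [mP _]; apply; rewrite mulr0.
    apply: sub_localization => //; last exact: subring0.
    exact: max_quasi_prime_ideal mP.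
  - move=> u v [Du fu] [Dv fv]; split; first exact: subringD.
    have : finite_set (bad u `|` bad v) by rewrite finite_setU.
    apply: sub_finite_set => P [mP Pa h].
    have hV := localization_subring hR (max_quasi_prime_ideal hR hs mP).
    have [hu|nu] := pselect (localization D P (a^-1 * u)); last by left.
    right; split=> // hv; apply: h; rewrite mulrDr; exact: subringD.
  - move=> c u Dc [Du fu]; split; first exact: subringM.
    apply: sub_finite_set fu => P [mP Pa h]; split=> // hu; apply: h.
    have hpr := max_quasi_prime_ideal hR hs mP.
    rewrite mulrCA; apply: (subringM (localization_subring hR hpr)) => //.
    exact: sub_localization.
have Ba : B a.
  split=> //; apply: sub_finite_set (finite_set0 _) => P [mP _]; apply.
  have hpr := max_quasi_prime_ideal hR hs mP.
  by rewrite mulVf //; apply: sub_localization => //; apply: subring1.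
have hB : nonzero_ideal D B by split; [exact: Fbar_intro sB a0 Ba | move=> u []].
have [r [[z z0 zr] rB Bs]] := star_Noetherian_fg hR hs hN hB.
have : finite_set [set P | exists2 u, u \in r & bad u P].
  elim: r rB {z z0 zr Bs} => [|u r IH] rB.
    by apply: sub_finite_set (finite_set0 _) => P [].
  have [_ hu] := rB u (mem_head _ _).
  have hr : finite_set [set P | exists2 u, u \in r & bad u P].
    by apply: IH => v vr; apply: rB; rewrite inE vr orbT.
  have : finite_set (bad u `|` [set P | exists2 u, u \in r & bad u P]).
    by rewrite finite_setU.
  apply: sub_finite_set => P [v]; rewrite inE => /orP[/eqP -> //|vr hv].
    by move=> ?; left.
  by right; exists v.
(* If [P] is bad for no generator, [a^-1 * d] is in [V_P] for every [d] in [B]; an element [y * a]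
   of [B] will violate this. *)
apply: sub_finite_set => P [mP Pa]; apply: contrapT => nbad.
have hpr := max_quasi_prime_ideal hR hs mP; have [qP nP1 maxP] := mP.
have hV := localization_subring hR hpr.
have BV d : B d -> localization D P (a^-1 * d).
  move=> /Bs; apply: (star_fgen_sub_localization hD hs hP qP hpr).
    exact: fgen_mspan z0 zr.
  apply: mspan_min => [|u ur].
    apply: submodule_preim_mul.
    exact: submodule_sub (sub_localization hR hpr) (submodule_self hV).
  by apply: contrapT => h; apply: nbad; exists u.
have [F [x [y [[hF FP PF Fa] Fx hy nxy]]]] := quasi_prime_inverse hD hs hP qP hpr hN Pa.
have Bya : B (y * a).
  split; first exact: hy.
  (* Only [P] itself can be bad for [y * a]. If [P'] contains [F], it contains [P] by closure and
     equals it; otherwise some [f] in [F] outside [P'] writes [y] as [(y * f) / f]. *)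
  apply: (sub_finite_set _ (finite_set1 P)) => P' [mP' P'a h].
  have hpr' := max_quasi_prime_ideal hR hs mP'; have [qP' nP1' _] := mP'.
  have [FP'|] := pselect (F `<=` P').
    apply: maxP => // w Pw.
    have [hP' ->] := qP'; split; last by case: hpr => _ + _ _; apply.
    by apply: (semistar_mono hs (fgen_Fbar hF) (Fbar_ideal hP') FP'); apply: PF.
  move=> nF; exfalso; apply: nF => f Ff; apply: contrapT => nf; apply: h.
  have f0 := prime_notin_neq0 hpr' nf.
  have -> : a^-1 * (y * a) = (y * f) / f by field; rewrite a0 f0.
  by apply: localization_frac => //; [exact: hy | case: hpr => _ PD _ _; apply: PD; apply: FP].
(* Now [y] is in [V_P] and [x * y] is a unit there, so [x^-1] is in [V_P] although [x] is in [P]. *)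
have := prime_notin_neq0 hpr nxy; rewrite mulf_eq0 negb_or => /andP[x0 y0].
apply: (localization_invN hpr x0 (FP _ Fx)).
have -> : x^-1 = a^-1 * (y * a) * (1 / (x * y)) by field; rewrite a0 x0 y0.
apply: subringM => //; first exact: BV.
apply: localization_frac => //; first exact: subring1.
by rewrite mulrC; apply: hy.
Qed.

Lemma overring_quotient_field (R T : set K) : has_quotient_field R -> overring R T ->
  has_quotient_field T.
Proof.
move=> [_ h] [hT RT]; split=> // x; have [a [b [Ra Rb b0 E]]] := h x.
by exists a, b; split=> //; apply: RT.
Qed.

Lemma star_self_overring : overring D (star D).
Proof. by split; [exact: star_self_subring | exact: sub_star_self]. Qed.

(** The family consists of the valuations of the [V_P] with [P] maximal. If [x = a / b] has nonzero
    value at [P], then [a] or [b] lies in [P], which leaves finitely many [P]. *)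
Lemma Krull_star_self : Krull (star D).
Proof.
split; first exact/(overring_quotient_field hD)/star_self_overring.
pose L := {P | max_quasi D star P}.
have /choice[v hv] : forall l : L, exists v,
    discrete_valuation v /\ valuation_ring v = localization D (sval l).
  case=> P mP /=; have [qP _ _] := mP.
  exact: (quasi_prime_valuation hD hs hP qP (max_quasi_prime_ideal hR hs mP) hN).
exists L, v; split=> [l||x x0]; first by case: (hv l).
  rewrite star_self_bigcap; apply/seteqP; split=> x hx.
    by move=> l _; have [_ ->] := hv l; apply/hx/svalP.
  by move=> P mP; have := hx (exist _ P mP) I; have [_ ->] := hv (exist _ P mP).
have [a [b [Da Db b0 xE]]] := proj2 hD x.
have a0 : a != 0 by apply/eqP => z; move: x0; rewrite xE z mul0r eqxx.
have fin : finite_set ([set P | max_quasi D star P /\ P a] `|`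
    [set P | max_quasi D star P /\ P b]).
  by rewrite finite_setU; split; apply: finitely_many_max_quasi.
have sval_inj : {in sval @^-1` ([set P | max_quasi D star P /\ P a] `|`
    [set P | max_quasi D star P /\ P b]) &, injective (@sval _ (max_quasi D star))}.
  by move=> [P mP] [Q mQ] _ _ /= PQ; apply: eq_exist.
apply: sub_finite_set (finite_preimage sval_inj fin) => -[P mP] /= /eqP vx.
have hpr := max_quasi_prime_ideal hR hs mP.
have [hl /= hV] := hv (exist _ P mP).
apply: contrapT => nab; apply: vx.
have na : ~ P a by move=> Pa; apply: nab; left.
have nb : ~ P b by move=> Pb; apply: nab; right.
have : localization D P x by rewrite xE; apply: localization_frac.
have : localization D P x^-1 by rewrite xE invf_div; apply: localization_frac.
rewrite -hV => /(_ (invr_neq0 x0)) + /(_ x0) vx; rewrite (valuationV hl x0) => vV.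
by apply/eqP; rewrite eq_le vx -oppr_ge0 vV.
Qed.

Lemma mulmod_sub_mspan (T : set K) E u : GRing.subring_closed (mem T) -> mulmod E T u ->
  exists2 r, (forall x, x \in r -> E x) & mspan T r u.
Proof.
move=> hT; pose M := [set u | exists2 r, (forall x, x \in r -> E x) & mspan T r u].
have sM : submodule T M.
  split.
  - by exists [::] => //; case: (mspan_submodule [::] hT).
  - move=> x y [r hr hx] [q hq hy]; exists (r ++ q).
      by move=> z; rewrite mem_cat => /orP[/hr|/hq].
    case: (mspan_submodule (r ++ q) hT) => _ hA _; apply: hA.
      by move: hx; apply: mspan_sub => // z zr; rewrite mem_cat zr.
    by move: hy; apply: mspan_sub => // z zr; rewrite mem_cat zr orbT.
  - move=> a x Ta [r hr hx]; exists r => //.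
    exact: (submoduleM (mspan_submodule r hT)).
apply: (mulmod_min sM) => x y Ex Ty; exists [:: x].
  by move=> z; rewrite inE => /eqP ->.
rewrite mulrC; apply: (submoduleM (mspan_submodule _ hT)) => //.
by apply: mspan_mem; rewrite ?mem_head.
Qed.

(** Finitely many elements of [mulmod E (star D)] involve only finitely many elements of [E], and
    the spans of one list over [D] and over [star D] have the same [v]-closure. So the finitely
    generated modules on the two sides can be compared. *)
Lemma finite_type_t_op E : Fbar D E ->
  finite_type D star E = t_op (star D) (mulmod E (star D)).
Proof.
move=> hE; have hT := star_self_subring hD hs; have DT := sub_star_self hD hs.
apply/seteqP; split=> x.
  move=> [F [hF FE]]; rewrite (star_fgen hD hs hP hF).
  have [hF' [r Fr]] := fgenP hR hF; rewrite Fr in hF' FE *.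
  have [z z0 zr] := mspan_neq0 hR hF' => vx.
  exists (mspan (star D) r); split; first exact: fgen_mspan z0 zr.
    apply: mspan_min; first exact/submodule_mulmod/submodule_self.
    move=> u ur; rewrite -(mulr1 u); apply: mulmod_mem; last exact: subring1.
    by apply: FE; apply: mspan_mem.
  by move: vx; apply: v_op_sub; apply: mspan_sub.
move=> [G [hG GE vx]]; have [hG' [r Gr]] := fgenP hT hG; rewrite Gr in hG' GE vx.
have [q qE rq] : exists2 q, (forall x, x \in q -> E x) &
    forall u, u \in r -> mspan (star D) q u.
  have : forall u, u \in r -> mulmod E (star D) u.
    by move=> u ur; apply: GE; apply: mspan_mem.
  elim: r {hG' Gr GE vx} => [|u r IH] h; first by exists [::].
  have [|q hq hr] := IH; first by move=> w wr; apply: h; rewrite inE wr orbT.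
  have [q' hq' hu] := mulmod_sub_mspan hT (h u (mem_head _ _)).
  exists (q' ++ q); first by move=> z; rewrite mem_cat => /orP[/hq'|/hq].
  move=> w; rewrite inE => /orP[/eqP ->|/hr].
    by move: hu; apply: mspan_sub => // z zr; rewrite mem_cat zr.
  by apply: mspan_sub => // z zr; rewrite mem_cat zr orbT.
have [z z0 zq] : exists2 z, z != 0 & z \in q.
  apply: (mspan_neq0 hT); have [w w0 hw] := Fbar_neq0 hG'.
  apply: (Fbar_intro (mspan_submodule q hT) w0).
  by move: hw; apply: mspan_min; first exact: mspan_submodule.
have hF : fgen D (mspan D q) by exact: fgen_mspan z0 zq.
exists (mspan D q); split=> //; first by apply: mspan_min => //; case: hE.
rewrite (star_fgen hD hs hP hF) /v_op colon_mspan // -(colon_mspan q hT hT) //.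
by move: vx; apply: v_op_sub; apply: mspan_min; first exact: mspan_submodule.
Qed.

(** An element [b] of [star D] outside [Q] is [c / d] over [D] with [d] outside [Q]. Then
    [c = b * d] is outside [Q] by primality, so [b] is invertible in the localization of [D]. *)
Lemma localization_prime_over_quasi Q : quasi_ideal D star (Q `&` D) ->
  prime_ideal (star D) Q -> localization D (Q `&` D) = localization (star D) Q.
Proof.
move=> qP hQ; have DT := sub_star_self hD hs; have hT := star_self_subring hD hs.
have [sQ QT n1 hpr] := hQ.
have hprP := prime_ideal_contract hR DT hQ.
have hV := localization_subring hR hprP.
have TV := star_self_sub_localization hD hs hP qP hprP.
apply/seteqP; split=> [_ [a [b [Da Db nb ->]]]|_ [a [b [Ta Tb nb ->]]]].
  apply: localization_frac; try exact: DT.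
  by move=> Qb; apply: nb.
apply: (subringM hV); first exact: TV.
have [c [d [Dc Dd nd E]]] := TV b Tb; have d0 := prime_notin_neq0 hprP nd.
rewrite E invf_div; apply: localization_frac => //.
move=> [Qc _]; have nQd : ~ Q d by move=> Qd; apply: nd.
apply: nb; apply: (hpr d) => //; first exact: DT.
by rewrite E mulrC divfK.
Qed.

End StarDedekindKrull.

(** * Krull domains *)

Section KrullDomain.
Set Implicit Arguments.
Unset Strict Implicit.
Import Order.TTheory GRing.Theory Num.Theory.
Variables (K : fieldType) (T : set K).
Hypothesis hK : Krull T.
Implicit Types (E F I J P Q : set K) (r : seq K).

Let hT : GRing.subring_closed (mem T) := proj1 (proj1 hK).

(** Take [x0] and, for each of the finitely many valuations nonzero at [x0], an element of [I] of
    least value. At the remaining valuations [x0] itself has the least possible value 0. *)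
Lemma Krull_colon_finite I x0 : I `<=` T -> x0 != 0 -> I x0 ->
  exists r, [/\ x0 \in r, forall x, x \in r -> I x &
    forall z, (forall x, x \in r -> T (z * x)) -> forall x, I x -> T (z * x)].
Proof.
move=> IT x00 Ix0; have [_ [L [v [hv TE fin]]]] := hK.
have Tv l x : T x -> x != 0 -> 0 <= v l x by rewrite TE => /(_ l Logic.I).
have /choice[y hy] : forall l, exists y, [/\ I y, y != 0 &
    forall x, I x -> x != 0 -> v l y <= v l x].
  move=> l.
  have hex : exists n : nat, `[< exists x, [/\ I x, x != 0 & v l x = n] >].
    exists `|v l x0|%N; apply/asboolP; exists x0; split=> //.
    by rewrite gez0_abs //; apply: Tv => //; apply: IT.
  case: (ex_minnP hex) => n /asboolP[y [Iy y0 vy]] hmin; exists y; split=> // x Ix xn0.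
  have vx := Tv l x (IT _ Ix) xn0.
  rewrite vy -(gez0_abs vx) lez_nat; apply: hmin; apply/asboolP.
  by exists x; split=> //; rewrite gez0_abs.
have [r rE] : exists r, y @` [set l | v l x0 != 0] = [set` r].
  by apply/finite_seqP/finite_image/fin.
have memr u : u \in r -> exists2 l, v l x0 != 0 & y l = u.
  by move=> ur; have : [set` r] u by []; rewrite -rE => -[l hl <-]; exists l.
exists (x0 :: r); split; first exact: mem_head.
  by move=> u; rewrite inE => /orP[/eqP -> //|/memr[l _ <-]]; have [] := hy l.
move=> z hz x Ix.
have key l u w : u != 0 -> w != 0 -> v l u <= v l w -> T (z * u) -> z * w != 0 ->
    0 <= v l (z * w).
  move=> u0 w0 uw Tzu; rewrite mulf_eq0 negb_or => /andP[zn0 _].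
  have := Tv l _ Tzu (mulf_neq0 zn0 u0); have [hM _ _] := hv l.
  by rewrite !hM //; lia.
rewrite TE => l _ zx0; have x1 : x != 0.
  by move: zx0; rewrite mulf_eq0 negb_or => /andP[].
have [vl|vl] := eqVneq (v l x0) 0.
  by apply: (key l x0) => //; [rewrite vl; apply: Tv => //; apply: IT | apply: hz; apply: mem_head].
have [Iy y0 ymin] := hy l.
apply: (key l (y l)) => //; first exact: ymin.
have : (y @` [set l | v l x0 != 0]) (y l) by exists l.
by rewrite rE => yr; apply: hz; rewrite inE yr orbT.
Qed.

Lemma v_op_sub_ring E : E `<=` T -> v_op T E `<=` T.
Proof. by move=> ET x hx; rewrite -(mulr1 x); apply: hx => e /ET; rewrite mul1r. Qed.

Lemma Krull_v_op_finite I : I `<=` T -> (exists2 x, x != 0 & I x) ->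
  exists r, [/\ exists2 x, x != 0 & x \in r, forall x, x \in r -> I x &
    I `<=` v_op T (mspan T r)].
Proof.
move=> IT [x x0 Ix]; have [r [xr rI hr]] := Krull_colon_finite IT x0 Ix.
exists r; split=> //; first by exists x.
by move=> w Iw z; rewrite colon_mspan // mulrC => /hr; apply.
Qed.

(** The [v]-closure of a finite subset of [E] already contains [E], hence also [v_op T E] by
    idempotence. *)
Lemma Krull_t_op_v_op E : nonzero_ideal T E -> t_op T E = v_op T E.
Proof.
move=> [hE ET]; have [x x0 Ex] := Fbar_neq0 hE.
have [r [[z z0 zr] rE Er]] : exists r, [/\ exists2 x, x != 0 & x \in r,
    forall x, x \in r -> E x & E `<=` v_op T (mspan T r)].
  by apply: Krull_v_op_finite => //; exists x.
apply/seteqP; split=> w; first by move=> [F [_ FE]]; apply: v_op_sub.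
move=> hw; exists (mspan T r); split; first exact: fgen_mspan z0 zr.
  by apply: mspan_min => //; case: hE.
have hF := Fbar_mspan hT z0 zr.
rewrite -(semistar_idem (semistar_v_op hT) hF); move: hw; exact: v_op_sub.
Qed.

Lemma Krull_star_Noetherian : star_Noetherian T (v_op T).
Proof.
by apply: (star_Noetherian_of_fg hT (semistar_v_op hT)) => I; apply: Krull_v_op_finite.
Qed.

(** This rests on [t = v] for ideals of a Krull domain; through it, existence and primality of
    maximal quasi-ideals become statements on t-maximal ideals. *)
Lemma proper_t_idealP I : proper_t_ideal T I <-> quasi_ideal T (v_op T) I /\ ~ I 1.
Proof.
split=> [[hI IT tI]|[[hI IE] nI1]].
  have vI : v_op T I = I by rewrite -Krull_t_op_v_op.
  have [[sI _] IsT] := hI; split.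
    by split=> //; rewrite vI; apply/esym/setIidPl.
  move=> I1; apply: IT; apply/seteqP; split=> // x Tx.
  by rewrite -(mulr1 x); apply: (submoduleM sI).
split=> //; first by move=> IT; apply: nI1; rewrite IT; apply: subring1.
rewrite Krull_t_op_v_op // {2}IE; apply/esym/setIidPl.
by apply: v_op_sub_ring; case: hI.
Qed.

Lemma t_maximalP Q : t_maximal T Q <-> max_quasi T (v_op T) Q.
Proof.
split=> [[/proper_t_idealP[qQ nQ] hmax]|[qQ nQ hmax]].
  by split=> // J qJ nJ; apply: hmax; apply/proper_t_idealP.
split; first exact/proper_t_idealP.
by move=> J /proper_t_idealP[qJ nJ]; apply: hmax.
Qed.

(* Krull domains are completely integrally closed: the powers of an element [z]
   that multiplies [(T : E)] into itself have a common denominator. *)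
Lemma Krull_v_invertible E : nonzero_ideal T E -> v_op T (mulmod E (colon T E)) 1.
Proof.
move=> [hE ET] z hz; rewrite mul1r; have [_ [L [v [hv TE fin]]]] := hK.
have [e e0 Ee] := Fbar_neq0 hE.
have hC n : colon T E (z ^+ n).
  elim: n => [|n IH]; first by move=> x /ET; rewrite mul1r.
  move=> x Ex; rewrite exprS -mulrA (mulrC _ x); apply: hz; exact: mulmod_mem.
rewrite TE => l _ z0; have : forall n : nat, 0 <= v l e + v l z *+ n.
  move=> n; have zn0 : z ^+ n != 0 by rewrite expf_neq0.
  have := hC n _ Ee; rewrite TE => /(_ l Logic.I); rewrite /valuation_ring /=.
  have [hM _ _] := hv l; rewrite mulf_neq0 // => /(_ isT).
  by rewrite hM // valuationX // addrC.
(* Were [v l z] negative, this exponent would make the sum at most -1. *)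
move=> /(_ `|v l e|.+1); rewrite leNgt => h; rewrite leNgt; apply: contraNN h.
by rewrite -mulr_natr; nia.
Qed.

End KrullDomain.

(** * Localizations at t-maximal ideals, and the converse implication *)

Section Characterization.
Set Implicit Arguments.
Unset Strict Implicit.
Import GRing.Theory.
Variables (K : fieldType) (D : set K) (star : set K -> set K).
Hypotheses (hD : has_quotient_field D) (hs : semistar D star).

Let hR : GRing.subring_closed (mem D) := proj1 hD.

(** The point is that the trace of [Q] is a quasi-star-ideal: its closure lies in [star F] for a
    finitely generated [F] inside it, and [star F] is the [v]-closure of [F], contained in that of
    [Q]. *)
Lemma star_Dedekind_localization Q : star_Noetherian D star -> PstarMD D star ->
  t_maximal (star D) Q -> localization D (Q `&` D) = localization (star D) Q.
Proof.
move=> hN hP; have hK := Krull_star_self hD hs hN hP.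
have hT := star_self_subring hD hs; have DT := sub_star_self hD hs.
move=> /(t_maximalP hK) mQ.
have hQ := max_quasi_prime_ideal hT (semistar_v_op hT) mQ.
have [[hQT QE] nQ1 _] := mQ; have [[sQ _] QT] := hQT.
apply: localization_prime_over_quasi => //.
have [q q0 Qq] := Fbar_neq0 (Fbar_ideal hQT).
have [a [b [Da Db b0 qE]]] := proj2 hD q.
have a0 : a != 0 by apply/eqP => z; move: q0; rewrite qE z mul0r eqxx.
have hI : nonzero_ideal D (Q `&` D).
  split; last by move=> x [].
  apply: (Fbar_intro _ a0).
    by apply: submoduleI; [exact: submodule_sub DT sQ|exact: submodule_self].
  have aE : a = b * q by rewrite qE mulrC divfK.
  by split=> //; rewrite aE; apply: (submoduleM sQ) => //; apply: DT.
split=> //; apply/seteqP; split=> [x Ix|x [sx Dx]].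
  by split; [exact: (semistar_ext hs (Fbar_ideal hI)) | case: Ix].
split=> //; rewrite QE; split; last exact: DT.
have [r [[z z0 zr] rQ hr]] := star_Noetherian_fg hR hs hN hI.
have hF := fgen_mspan hR z0 zr.
have : star (mspan D r) x.
  exact: (semistar_min hs (Fbar_ideal hI) (fgen_Fbar hF) hr).
rewrite (star_fgen hD hs hP hF); apply: v_op_sub.
by apply: mspan_min => [|y /rQ[]//]; exact: submodule_sub DT sQ.
Qed.

(** * Descent from a Krull overring to [D] *)

Section Converse.
Variable T : set K.
Hypotheses (hDT : overring D T) (hK : Krull T).
Hypothesis hstar : forall E, Fbar D E -> finite_type D star E = t_op T (mulmod E T).

Let hT : GRing.subring_closed (mem T) := proj1 hDT.
Let DT : D `<=` T := proj2 hDT.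

Lemma mulmod_ideal E : Fbar D E -> E `<=` T -> nonzero_ideal T (mulmod E T).
Proof.
move=> hE ET; split; first exact: (Fbar_mulmod hE (Fbar_self hT)).
by apply: (mulmod_min (submodule_self hT)) => x y /ET Tx Ty; apply: subringM.
Qed.

Lemma sub_mulmodr E : E `<=` mulmod E T.
Proof. by move=> x Ex; rewrite -(mulr1 x); apply: mulmod_mem => //; apply: subring1. Qed.

Lemma finite_type_v_op E : nonzero_ideal D E ->
  finite_type D star E = v_op T (mulmod E T).
Proof.
move=> [hE ED]; rewrite hstar // Krull_t_op_v_op //.
by apply: mulmod_ideal => // x /ED /DT.
Qed.

(** The finite list found over [T] also serves over [D]: the formula turns the [v]-closure of the
    extended span into a finite type closure, which lies in the closure under [star]. *)
Lemma Krull_overring_star_Noetherian : star_Noetherian D star.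
Proof.
apply: (star_Noetherian_of_fg hR hs) => J JD Jn0.
have JT : J `<=` T by move=> x /JD /DT.
have [r [[z z0 zr] rJ hr]] := Krull_v_op_finite hK JT Jn0.
exists r; split=> //; first by exists z.
have hF := fgen_mspan hR z0 zr.
have hFD : nonzero_ideal D (mspan D r).
  by split; [exact: fgen_Fbar | apply: mspan_min => [|x /rJ /JD //]; exact: submodule_self].
move=> y /hr vy; have [F [hF' FE sF]] : finite_type D star (mspan D r) y.
  rewrite finite_type_v_op //; move: vy; apply: v_op_sub.
  apply: mspan_min; first exact/submodule_mulmod/submodule_self.
  by move=> u ur; apply: sub_mulmodr; apply: mspan_mem.
exact: (semistar_mono hs (fgen_Fbar hF') (fgen_Fbar hF)) sF.
Qed.

Hypothesis hloc : forall Q, t_maximal T Q -> localization D (Q `&` D) = localization T Q.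

Lemma Krull_overring_PstarMD : PstarMD D star.
Proof.
move=> I hI hfI; have [hIF ID] := hI; rewrite /star_invertible.
have IT : I `<=` T by move=> x /ID /DT.
have hB : nonzero_ideal D (mulmod I (colon D I)).
  split; first exact/(Fbar_mulmod hIF)/Fbar_colon_fgen.
  by apply: (mulmod_min (submodule_self hR)) => x y Ix hy; rewrite mulrC; apply: hy.
have BT : mulmod I (colon D I) `<=` T by move=> x; case: hB => _ h /h /DT.
have hDD : nonzero_ideal D D by split => //; exact: Fbar_self.
rewrite !finite_type_v_op //.
have hC := mulmod_ideal (Fbar_ideal hB) BT; set C := mulmod _ T in hC *.
have sv E : submodule T (v_op T E) by exact: submodule_colon.
have vD1 : v_op T (mulmod D T) 1 by apply: sub_v_op; apply: sub_mulmodr; apply: subring1.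
(* Both sides are [v]-closures of ideals of [T], and such a closure is all of [T] once it contains
   1. *)
suff vC1 : v_op T C 1.
  have full E : nonzero_ideal T E -> v_op T E 1 -> v_op T E = T.
    move=> [_ ET] h1; apply/seteqP; split; first exact: v_op_sub_ring.
    by move=> x Tx; rewrite -(mulr1 x); apply: (submoduleM (sv E)).
  have hDT' := mulmod_ideal (Fbar_ideal hDD) DT.
  by rewrite (full C hC vC1) (full _ hDT' vD1).
apply: contrapT => nC1.
have [Q mQ CQ] := max_quasi_exists hT (semistar_v_op hT) (Krull_star_Noetherian hK) hC nC1.
have hQ := max_quasi_prime_ideal hT (semistar_v_op hT) mQ.
have [sQ QT n1 hpr] := hQ.
have hprP := prime_ideal_contract hR DT hQ.
have hE := mulmod_ideal hIF IT.
(* If every such product were in [Q], the [v]-invertibility of [mulmod I T] would put 1 in the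
   [v]-closure of [Q], hence in [Q]. *)
have [i [y [Ii hy nQ]]] : exists i y, [/\ I i, forall j, I j -> T (y * j) & ~ Q (y * i)].
  apply: contrapT => hno; apply: n1; have [[[_ _] QE] _ _] := mQ; rewrite QE.
  split; last exact: subring1.
  move: (Krull_v_invertible hK hE); apply: v_op_sub.
  apply: (mulmod_min sQ) => x y Ex hy; rewrite mulrC.
  move: x Ex; apply: (mulmod_min (submodule_preim_mul y sQ)) => i t Ii Tt /=.
  have -> : y * (i * t) = t * (y * i) by ring.
  apply: (submoduleM sQ) => //.
  apply: contrapT => nQ; apply: hno; exists i, y; split=> //.
  by move=> j Ij; apply: hy; apply: sub_mulmodr.
have [_ [r Ir]] := fgenP hR hfI.
(* By [hloc] each [y * x] is a fraction over [D] with denominator outside [Q], so a common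
   denominator [s] moves [y] into [colon D I]. *)
have [s [Ds ns hr]] : exists s, [/\ D s, ~ (Q `&` D) s & forall x, x \in r -> D (s * (y * x))].
  apply: (localization_denom hR hprP) => x xr.
  rewrite hloc; last exact/(t_maximalP hK).
  by apply: (sub_localization hT hQ); apply: hy; rewrite Ir; apply: mspan_mem.
have hsy : colon D I (s * y).
  by rewrite Ir colon_mspan // => x xr; rewrite -mulrA; apply: hr.
(* The product [s * (y * i)] is in [C] and so in [Q]; since [s] is not, primality puts [y * i] in
   [Q]. *)
apply: nQ; apply: (hpr s); first exact: DT.
- exact: hy.
- rewrite mulrA mulrC; apply: CQ; apply: sub_mulmodr; exact: mulmod_mem.
- by move=> Qs; apply: ns.
Qed.

End Converse.
End Characterization.

Theorem mainTheorem4 (K : fieldType) (D : set K)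
    (hD : has_quotient_field D)
    (star : set K -> set K) (hstar : semistar D star) :
  star_Dedekind D star <->
  exists T : set K,
    [/\ overring D T,
        Krull T,
        forall E : set K, Fbar D E ->
          finite_type D star E = t_op T (mulmod E T) &
        forall Q : set K, t_maximal T Q ->
          localization D (Q `&` D) = localization T Q].
Proof.
split=> [[hN hP]|[T [hDT hK hf hloc]]].
  exists (star D); split.
  - exact: star_self_overring.
  - exact: Krull_star_self.
  - exact: finite_type_t_op.
  - by move=> Q; apply: star_Dedekind_localization.
split; first exact: Krull_overring_star_Noetherian hK hf.
exact: Krull_overring_PstarMD hK hf hloc.
Qed.
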